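(* Let $(M,g)$ be a Riemannian manifold of dimension $m\geq2$ with a metric connection $\nabla$ (i.e. $\nabla g=0$, torsion allowed). Let $f_1=e^{2\varphi_1}$, $f_2=e^{2\varphi_2}$ with $\varphi_1,\varphi_2\in C^\infty(M)$, and put $\psi=\varphi_2-\varphi_1$, $\overline\psi=\varphi_2+\varphi_1$. On $TM$ with the metric $G=g^{f_1,f_2}$, the endomorphism $I^GX=e^{\psi}\theta^tX-e^{-\psi}\theta X$ of $TTM$ is an almost complex structure compatible with $G$ (i.e. $(I^G)^2=-1$ and $G(I^GX,I^GY)=G(X,Y)$ for all $X,Y$). The associated 2-form $\omega^G(X,Y)=G(I^GX,Y)$ satisfies $$\omega^G=e^{\overline\psi}\,\omega^S,$$ where $\omega^S(X,Y)=g^S(I^SX,Y)$ with $I^S=\theta^t-\theta$.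
   Context: Let $\pi:TM\to M$ be the bundle projection and $V=\ker d\pi\subset TTM$ the vertical bundle, canonically identified with $\pi^*TM$. Let $\xi$ be the canonical vertical vector field on $TM$, $\xi_u=u$, and $\nabla^*=\pi^*\nabla$ the pull-back connection on $\pi^*TM$. Then $H=\{X\in TTM:\ \nabla^*_X\xi=0\}$ is a complement of $V$ and $d\pi$ restricts to an isomorphism $H\cong\pi^*TM$. The endomorphism $\theta:TTM\to TTM$ sends a horizontal vector to the corresponding vertical vector under $H\cong\pi^*TM\cong V$ and sends $V$ to $0$; $\theta^t$ sends a vertical vector to the corresponding horizontal vector and sends $H$ to $0$. The metrics are $G=g^{f_1,f_2}=f_1\pi^*g\oplus f_2\pi^*g$ and the Sasaki metric $g^S=\pi^*g\oplus\pi^*g$ on $TTM=H\oplus V$ (with $H\perp V$). Functions on $M$ are composed with $\pi$ when used on $TM$. *)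

(* Defs.v *)
From HB Require Import structures.
From mathcomp Require Import all_boot all_order all_algebra.
From mathcomp Require Import all_classical all_reals all_analysis.

Set Implicit Arguments.
Unset Strict Implicit.
Unset Printing Implicit Defensive.

Import Order.TTheory GRing.Theory Num.Theory.
Import numFieldNormedType.Exports.

Local Open Scope classical_set_scope.
Local Open Scope ring_scope.

(* The argument [D] is meant to be open: ['D_v f] only looks at [f] near a
   point. *)
Fixpoint Ck_on (R : realType) (n : nat) (W : normedModType R) (k : nat)
    (D : set 'rV[R]_n) (f : 'rV[R]_n -> W) : Prop :=
  if k is k'.+1 then
    (forall x, D x -> differentiable f x) /\
    (forall v, Ck_on k' D ('D_v f))
  else forall x, D x -> {for x, continuous f}.

(* "f is C^oo on a neighbourhood of x". The neighbourhood does not depend on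
   the order of differentiability. *)
Definition smooth_near (R : realType) (n : nat) (W : normedModType R)
    (f : 'rV[R]_n -> W) (x : 'rV[R]_n) : Prop :=
  exists D : set 'rV[R]_n, [/\ open D, D x & forall k, Ck_on k D f].

(* Raw chart data on a set [M]. The chart [i] is defined on [dom i]; the values
   of [chart i] outside [dom i] and of [chart_inv i] outside of the image of
   [dom i] are irrelevant. No axiom is part of the record, so that the atlas of
   a tangent bundle can be written down directly. *)
Record atlas (R : realType) (M : Type) (n : nat) := Atlas {
  chart_index : Type;
  dom : chart_index -> set M;
  chart : chart_index -> M -> 'rV[R]_n;
  chart_inv : chart_index -> 'rV[R]_n -> M
}.
Arguments dom {R M n} _ _ _.
Arguments chart {R M n} _ _ _.
Arguments chart_inv {R M n} _ _ _.

Record smooth_manifold (R : realType) (M : topologicalType) (n : nat)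
    (A : atlas R M n) : Prop := SmoothManifold {
  manifold_hausdorff : hausdorff_space M;
  manifold_second_countable : @second_countable M;
  dom_cover : forall p, exists i, dom A i p;
  dom_open : forall i, open (dom A i);
  chart_open : forall i, open (chart A i @` dom A i);
  chartK : forall i p, dom A i p -> chart_inv A i (chart A i p) = p;
  chart_continuous : forall i, {within dom A i, continuous (chart A i)};
  chart_inv_continuous : forall i,
    {within chart A i @` dom A i, continuous (chart_inv A i)};
  transition_smooth : forall i j p, dom A i p -> dom A j p ->
    smooth_near (chart A j \o chart_inv A i) (chart A i p)
}.

Definition smooth_at (R : realType) (M : Type) (n : nat) (A : atlas R M n)
    (W : normedModType R) (f : M -> W) (p : M) : Prop :=
  forall i, dom A i p -> smooth_near (f \o chart_inv A i) (chart A i p).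

Definition smooth (R : realType) (M : Type) (n : nat) (A : atlas R M n)
    (W : normedModType R) (f : M -> W) : Prop :=
  forall p, smooth_at A f p.

Section tangent_space.
Context (R : realType) (M : Type) (n : nat) (A : atlas R M n) (p : M).

(* A tangent vector at [p] is the family of its coordinates in all the charts
   around [p], related by the differentials of the transition maps. The
   coordinates in a chart not defined at [p] are set to 0, so that equal vectors
   are equal families. *)
Definition tangent_pred : {pred (chart_index A -> 'rV[R]_n)} :=
  fun v => `[< (forall i, ~ dom A i p -> v i = 0) /\
    (forall i j, dom A i p -> dom A j p ->
       v j = 'd (chart A j \o chart_inv A i) (chart A i p) (v i)) >].

Lemma tangent_pred_submod : submod_closed tangent_pred.
Proof.
split.
  by apply/asboolP; split=> // i j _ _; rewrite [RHS]linear0.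
move=> a u v /asboolP[u0 uT] /asboolP[v0 vT].
have E i : (a *: u + v) i = a *: u i + v i by [].
apply/asboolP; split=> [i ip|i j ip jp]; rewrite !E.
  by rewrite u0// v0// scaler0 addr0.
by rewrite (uT i j)// (vT i j)// linearP.
Qed.
HB.instance Definition _ := GRing.isSubmodClosed.Build R _ tangent_pred
  tangent_pred_submod.

Record tangent := Tangent {
  coord_in :> chart_index A -> 'rV[R]_n;
  _ : coord_in \in tangent_pred
}.
HB.instance Definition _ := [isSub for coord_in].
HB.instance Definition _ := gen_eqMixin tangent.
HB.instance Definition _ := gen_choiceMixin tangent.
HB.instance Definition _ := [SubChoice_isSubLmodule of tangent by <:].

End tangent_space.

(* [dir_deriv], [differential] and [velocity] return the object that has the
   required expression in every chart around the point; it is unique as soon as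
   some chart is defined there, and it exists for arguments smooth there. *)

Definition dir_deriv (R : realType) (M : Type) (n : nat) (A : atlas R M n)
    (W : normedModType R) (p : M) (v : tangent A p) (f : M -> W) : W :=
  xget 0 [set w | forall i, dom A i p ->
    w = 'd (f \o chart_inv A i) (chart A i p) (v i)].

Definition differential (R : realType) (N M : Type) (n m : nat)
    (B : atlas R N n) (A : atlas R M m) (f : N -> M) (q : N)
    (X : tangent B q) : tangent A (f q) :=
  xget 0 [set w : tangent A (f q) | forall j, dom A j (f q) ->
    w j = dir_deriv X (chart A j \o f)].

(* The curve [c] is meant to satisfy [c 0 = p]. *)
Definition velocity (R : realType) (M : Type) (n : nat) (A : atlas R M n)
    (p : M) (c : R -> M) : tangent A p :=
  xget 0 [set w : tangent A p | forall i, dom A i p ->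
    w i = derive1 (chart A i \o c) 0].

(* The sections of [f^*TM], for a map [f : N -> M]; for [f = id] these are the
   vector fields on [M]. *)
Definition section_along (R : realType) (N M : Type) (m : nat)
    (A : atlas R M m) (f : N -> M) := forall q : N, tangent A (f q).

Definition smooth_section_at (R : realType) (N M : Type) (n m : nat)
    (B : atlas R N n) (A : atlas R M m) (f : N -> M)
    (s : section_along A f) (q : N) : Prop :=
  forall j, dom A j (f q) -> smooth_at B (fun q' => s q' j) q.

Definition vector_field (R : realType) (M : Type) (m : nat)
    (A : atlas R M m) := section_along A (@id M).

Definition smooth_field_at (R : realType) (M : Type) (m : nat)
    (A : atlas R M m) (X : vector_field A) (p : M) : Prop :=
  smooth_section_at A X p.

Definition tensor02 (R : realType) (M : Type) (m : nat) (A : atlas R M m) :=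
  forall p : M, tangent A p -> tangent A p -> R.

Record riemannian_metric (R : realType) (M : Type) (m : nat) (A : atlas R M m)
    (g : tensor02 A) : Prop := RiemannianMetric {
  metric_linear : forall p a (u v w : tangent A p),
    g p (a *: u + v) w = a * g p u w + g p v w;
  metric_sym : forall p (u v : tangent A p), g p u v = g p v u;
  metric_pos : forall p (u : tangent A p), u != 0 -> 0 < g p u u;
  metric_smooth : forall p (X Y : vector_field A),
    smooth_field_at X p -> smooth_field_at Y p ->
    smooth_at A (fun q => g q (X q) (Y q)) p
}.

Definition derivation_along (R : realType) (N M : Type) (n m : nat)
    (B : atlas R N n) (A : atlas R M m) (f : N -> M) :=
  forall q : N, tangent B q -> section_along A f -> tangent A (f q).

(* A connection on the bundle [f^*TM] over [N]. It acts on all sections smooth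
   near the point under consideration, that is on local sections: the Leibniz
   rule for a function [h] equal to 1 near [q] and to 0 away from [q] shows that
   [D q X s] depends only on the germ of [s] at [q]. *)
Record connection_along (R : realType) (N M : Type) (n m : nat)
    (B : atlas R N n) (A : atlas R M m) (f : N -> M)
    (D : derivation_along B A f) : Prop := ConnectionAlong {
  connection_linear : forall q a (X Y : tangent B q) (s : section_along A f),
    smooth_section_at B s q -> D q (a *: X + Y) s = a *: D q X s + D q Y s;
  connection_add : forall q (X : tangent B q) (s t : section_along A f),
    smooth_section_at B s q -> smooth_section_at B t q ->
    D q X (fun q' => s q' + t q') = D q X s + D q X t;
  connection_leibniz : forall q (X : tangent B q) (h : N -> R)
      (s : section_along A f),
    smooth_at B h q -> smooth_section_at B s q ->
    D q X (fun q' => h q' *: s q') = dir_deriv X h *: s q + h q *: D q X s;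
  connection_smooth : forall q (X : vector_field B) (s : section_along A f),
    smooth_field_at X q -> smooth_section_at B s q ->
    smooth_section_at B (fun q' => D q' (X q') s) q
}.

Definition affine_connection (R : realType) (M : Type) (m : nat)
    (A : atlas R M m) (nabla : derivation_along A A id) : Prop :=
  connection_along nabla.

Definition metric_connection (R : realType) (M : Type) (m : nat)
    (A : atlas R M m) (g : tensor02 A) (nabla : derivation_along A A id)
    : Prop :=
  affine_connection nabla /\
  forall p (v : tangent A p) (Y Z : vector_field A),
    smooth_field_at Y p -> smooth_field_at Z p ->
    dir_deriv v (fun q => g q (Y q) (Z q)) =
    g p (nabla p v Y) (Z p) + g p (Y p) (nabla p v Z).

(* [D] is the pull-back connection [f^*nabla], i.e. the connection on [f^*TM]
   such that [D_X (f^*Y) = nabla_(df X) Y]. *)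
Definition pullback_connection (R : realType) (N M : Type) (n m : nat)
    (B : atlas R N n) (A : atlas R M m) (f : N -> M)
    (nabla : derivation_along A A id) (D : derivation_along B A f) : Prop :=
  connection_along D /\
  forall q (X : tangent B q) (Y : vector_field A), smooth_field_at Y (f q) ->
    D q X (fun q' => Y (f q')) = nabla (f q) (differential A f X) Y.

Section tangent_bundle.
Context (R : realType) (M : Type) (m : nat) (A : atlas R M m).

Definition TM := {p : M & tangent A p}.

Definition TM_proj (u : TM) : M := projT1 u.

Definition TM_atlas : atlas R TM (m + m) := {|
  chart_index := chart_index A;
  dom := fun i u => dom A i (TM_proj u);
  chart := fun i u => row_mx (chart A i (TM_proj u)) (projT2 u i);
  chart_inv := fun i z =>
    existT _ (chart_inv A i (lsubmx z))
      (xget 0 [set v : tangent A (chart_inv A i (lsubmx z)) |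
        v i = rsubmx z])
|}.

Notation TTM u := (tangent TM_atlas u).

Definition dpi (u : TM) (X : TTM u) : tangent A (TM_proj u) :=
  differential A TM_proj X.

Definition vertical (u : TM) : set (TTM u) := [set X | dpi X = 0].

(* The canonical identification of [pi^*TM] with [V]: [w] at [u] is sent to the
   velocity at [t = 0] of the curve [u + t w] in the fibre. *)
Definition vertical_lift (u : TM) (w : tangent A (TM_proj u)) : TTM u :=
  velocity TM_atlas u (fun t => existT _ (TM_proj u) (projT2 u + t *: w)).

Definition of_vertical (u : TM) (X : TTM u) : tangent A (TM_proj u) :=
  xget 0 [set w | vertical_lift w = X].

(* The canonical vertical vector field, as a section of [pi^*TM = V]. *)
Definition xi : section_along A TM_proj := fun u => projT2 u.

Variable nablaS : derivation_along TM_atlas A TM_proj.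

Definition horizontal (u : TM) : set (TTM u) :=
  [set X | nablaS X xi = 0].

Definition hpart (u : TM) (X : TTM u) : TTM u :=
  xget 0 [set Y | horizontal Y /\ vertical (X - Y)].

Definition vpart (u : TM) (X : TTM u) : TTM u := X - hpart X.

Definition horizontal_lift (u : TM) (w : tangent A (TM_proj u)) : TTM u :=
  xget 0 [set X | horizontal X /\ dpi X = w].

Definition endoTTM := forall u : TM, TTM u -> TTM u.

Definition theta : endoTTM := fun u X => vertical_lift (dpi (hpart X)).

Definition theta_t : endoTTM := fun u X =>
  horizontal_lift (of_vertical (vpart X)).

(* [f1 pi^*g] on [H] plus [f2 pi^*g] on [V], with [H] and [V] orthogonal. *)
Definition weighted_metric (g : tensor02 A) (f1 f2 : M -> R)
    : tensor02 TM_atlas := fun u X Y =>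
  f1 (TM_proj u) * g (TM_proj u) (dpi (hpart X)) (dpi (hpart Y)) +
  f2 (TM_proj u) *
    g (TM_proj u) (of_vertical (vpart X)) (of_vertical (vpart Y)).

Definition sasaki_metric (g : tensor02 A) : tensor02 TM_atlas :=
  weighted_metric g (fun=> 1) (fun=> 1).

Definition I_G (psi : M -> R) : endoTTM := fun u X =>
  expR (psi (TM_proj u)) *: theta_t X - expR (- psi (TM_proj u)) *: theta X.

Definition I_S : endoTTM := fun u X => theta_t X - theta X.

End tangent_bundle.

Record almost_complex_structure (R : realType) (N : Type) (n : nat)
    (B : atlas R N n) (J : forall q : N, tangent B q -> tangent B q)
    : Prop := AlmostComplexStructure {
  acs_linear : forall q, linear (J q);
  acs_smooth : forall q (X : vector_field B), smooth_field_at X q ->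
    smooth_field_at (fun q' => J q' (X q') : tangent B (id q')) q;
  acs_square : forall q (X : tangent B q), J q (J q X) = - X
}.

Definition compatible (R : realType) (N : Type) (n : nat) (B : atlas R N n)
    (G : tensor02 B) (J : forall q : N, tangent B q -> tangent B q) : Prop :=
  forall q (X Y : tangent B q), G q (J q X) (J q Y) = G q X Y.

Definition associated_form (R : realType) (N : Type) (n : nat)
    (B : atlas R N n) (G : tensor02 B)
    (J : forall q : N, tangent B q -> tangent B q) : tensor02 B :=
  fun q X Y => G q (J q X) Y.

(* Main.v *)
Require Import Defs.
From HB Require Import structures.
From mathcomp Require Import all_boot all_order all_algebra.
From mathcomp Require Import all_classical all_reals all_analysis.
From mathcomp Require Import ring.

(* Let [K X := nabla^*_X xi]. In a chart of [M] around [p], writing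
   [xi = \sum_k y_k E_k] with the [E_k] pulled back from [M], the Leibniz rule
   and [nabla^*_X E_k = nabla_(d pi X) E_k] show that [K] of the vertical lift
   of [w] is [w]. Hence [(d pi, K) : T_u TM -> T_p M (+) T_p M] is a linear
   isomorphism, which turns [theta] into [(a, b) |-> (0, a)], [theta^t] into
   [(a, b) |-> (b, 0)] and [G] into [f_1 g (+) f_2 g]; the three identities are
   then 2 x 2 matrix computations. For smoothness, the horizontal lift of [w] is
   [L - vlift (K L)] for any field [L] with [d pi L = w], for instance the one
   with coordinates [(w, 0)] in a chart, and [K L] is smooth because the
   connection preserves smoothness. *)

Set Implicit Arguments.
Unset Strict Implicit.
Unset Printing Implicit Defensive.

Import Order.TTheory GRing.Theory Num.Theory.
Import numFieldNormedType.Exports.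

Local Open Scope classical_set_scope.
Local Open Scope ring_scope.

(** * Continuity and differentials in normed modules *)

Section differential_calculus.
Context (R : realType).

Lemma rV_linear_continuous (n : nat) (W : normedModType R)
  (L : {linear 'rV[R]_n -> W}) : continuous L.
Proof.
have -> : (L : _ -> _) =
    \sum_(i < n) (fun x : 'rV[R]_n => x 0 i *: L (delta_mx 0 i)).
  apply/funext => x; rewrite {1}(row_sum_delta x) linear_sum fct_sumE.
  by apply: eq_bigr => i _; rewrite linearZ.
move=> x; apply/differentiable_continuous/differentiable_sum => i.
by apply: differentiableZl; exact: differentiable_coord.
Qed.

(** The first-order expansion of [f] is also one of [g], since its remainder is judged only near 0;
    uniqueness of the differential then gives the equality. *)
Lemma near_eq_diff (V W : normedModType R) (f g : V -> W) (x : V) :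
  {near x, f =1 g} -> differentiable f x ->
  differentiable g x /\ 'd g x = 'd f x :> (V -> W).
Proof.
move=> fg df; have fgx := nbhs_singleton fg.
have [cdf Ef] := (diff_locallyP _ _).1 df.
have Eg : g \o shift x = cst (g x) + 'd f x +o_ 0 id.
  apply/eqaddoP => e e0; move/eqaddoP : Ef => /(_ e e0).
  have : \forall y \near 0, f (y + x) = g (y + x).
    by move: fg; rewrite (near_shift 0 x) subr0.
  by apply: filterS2 => y E /=; rewrite !fctE/= -fgx -E.
have E : 'd g x = 'd f x :> (V -> W) by exact: diff_unique.
split; last exact: E.
by apply/diff_locallyP; rewrite E.
Qed.

Lemma differentiable_scale (V W : normedModType R) (k : V -> R) (f : V -> W)
  (x : V) : differentiable k x -> differentiable f x ->
  differentiable (fun z => k z *: f z) x /\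
  forall v, 'd (fun z => k z *: f z) x v = 'd k x v *: f x + k x *: 'd f x v.
Proof.
move=> dk df.
(* Scalar multiplication is packaged as a continuous bilinear map, so that the product rule becomes
   the chain rule through the pair [(k, f)]. *)
have scale_bilinear : bilinear_for (GRing.Scale.Law.clone _ _ *:%R _)
    (GRing.Scale.Law.clone _ _ *:%R _) (@GRing.scale R W).
  split=> [w a b c|a b w w'] /=; first by rewrite scalerDl scalerA.
  by rewrite scalerDr !scalerA mulrC.
pose B : {bilinear R -> W -> W} := HB.pack (@GRing.scale R W)
  (bilinear_isBilinear.Build R R W W _ _ (@GRing.scale R W) scale_bilinear).
have Bc : continuous (fun p => B p.1 p.2).
  exact: scale_continuous.
have dp := differentiable_pair dk df.
have dB := differentiable_bilin (k x, f x) Bc.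
split; first exact: (differentiable_comp dp dB).
move=> v; have -> : (fun z => k z *: f z) =
  (fun p => B p.1 p.2) \o (fun z => (k z, f z)) by [].
rewrite diff_comp //= (diff_bilin _ Bc) (diff_pair dk df) /=.
by rewrite addrC.
Qed.

End differential_calculus.

(** * Functions of class C^k and smooth germs *)

Section Ck.
Context (R : realType) (n : nat).
Implicit Types D : set 'rV[R]_n.

(** Since [D] is open, agreement on [D] is agreement near each of its points; it therefore passes to
    directional derivatives, and the induction on [k] goes through. *)
Lemma Ck_on_congr (W : normedModType R) k D (f g : 'rV[R]_n -> W) : open D ->
  {in D, f =1 g} -> Ck_on k D f -> Ck_on k D g.
Proof.
move=> oD; have fgE (h l : 'rV[R]_n -> W) x : {in D, h =1 l} -> D x ->
    {near x, h =1 l}.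
  move=> hl Dx; apply: filterS (open_nbhs_nbhs (conj oD Dx)) => y Dy.
  by apply: hl; exact/mem_set.
elim: k f g => [|k IH] f g fg /=.
  move=> cf x Dx; have fgx := fgE _ _ _ fg Dx.
  rewrite /continuous_at /prop_for -(nbhs_singleton fgx).
  exact: cvg_trans (near_eq_cvg fgx) (cf x Dx).
case=> df Ckf; split=> [x Dx|v].
  by have [] := near_eq_diff (fgE _ _ _ fg Dx) (df x Dx).
apply: IH (Ckf v) => x /set_mem Dx.
by apply: near_eq_derive; exact: fgE Dx.
Qed.

Lemma Ck_on_sub (W : normedModType R) k D D' (f : 'rV[R]_n -> W) :
  D `<=` D' -> Ck_on k D' f -> Ck_on k D f.
Proof.
move=> DD'; elim: k f => [|k IH] f /=; first by move=> cf x /DD'/cf.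
by case=> df Ckf; split=> [x /DD'/df//|v]; exact: IH.
Qed.

Lemma Ck_onW (W : normedModType R) k D (f : 'rV[R]_n -> W) :
  Ck_on k.+1 D f -> Ck_on k D f.
Proof.
elim: k f => [|k IH] f /=; case=> df Ckf.
  by move=> x Dx; exact/differentiable_continuous/df.
by split=> // v; apply: IH; exact: Ckf.
Qed.

Lemma Ck_on_cst (W : normedModType R) k D (c : W) : Ck_on k D (cst c).
Proof.
elim: k c => [|k IH] c /=; first by move=> x _; exact: cst_continuous.
split=> [x _|v]; first exact: differentiable_cst.
rewrite (_ : 'D_v _ = cst 0); first exact: IH.
by apply/funext => x; rewrite derive_cst.
Qed.

Lemma Ck_on_linear (W : normedModType R) k D (L : {linear 'rV[R]_n -> W}) :
  Ck_on k D L.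
Proof.
have cL := rV_linear_continuous (L := L).
case: k => [|k] /=; first by move=> x _; exact: cL.
split=> [x _|v]; first exact: linear_differentiable.
rewrite (_ : 'D_v _ = cst (L v)); first exact: Ck_on_cst.
apply/funext => x; rewrite deriveE; last exact: linear_differentiable.
by rewrite diff_lin.
Qed.

Lemma Ck_onD (W : normedModType R) k D (f g : 'rV[R]_n -> W) : open D ->
  Ck_on k D f -> Ck_on k D g -> Ck_on k D (f \+ g).
Proof.
move=> oD; elim: k f g => [|k IH] f g /=.
  by move=> cf cg x Dx; exact: (@continuousD _ _ _ f g x (cf x Dx) (cg x Dx)).
move=> [df Ckf] [dg Ckg]; split=> [x Dx|v].
  by apply: differentiableD; [exact: df|exact: dg].
apply: Ck_on_congr (IH _ _ (Ckf v) (Ckg v)) => // x /set_mem Dx /=.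
by rewrite deriveD//; apply: diff_derivable; [exact: df|exact: dg].
Qed.

(** By the Leibniz rule the derivative is a sum of two products; in each, the undifferentiated
    factor is lowered from C^(k+1) to C^k by [Ck_onW]. *)
Lemma Ck_on_scale (W : normedModType R) k D (h : 'rV[R]_n -> R)
    (f : 'rV[R]_n -> W) : open D ->
  Ck_on k D h -> Ck_on k D f -> Ck_on k D (fun x => h x *: f x).
Proof.
move=> oD; elim: k h f => [|k IH] h f.
  by move=> ch cf x Dx; exact: (cvgZ (ch x Dx) (cf x Dx)).
move=> Ch Cf; have [dh Ckh] := Ch; have [df Ckf] := Cf; split=> [x Dx|v].
  by have [] := differentiable_scale (dh x Dx) (df x Dx).
apply: (Ck_on_congr oD _ (Ck_onD oD (IH _ _ (Ckh v) (Ck_onW Cf))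
  (IH _ _ (Ck_onW Ch) (Ckf v)))) => x /set_mem Dx /=.
have [d E] := differentiable_scale (dh x Dx) (df x Dx).
by rewrite [RHS]deriveE// E !deriveE//; [exact: df|exact: dh].
Qed.

Lemma Ck_on_linear_comp (m : nat) (W : normedModType R) k D
    (L : {linear 'rV[R]_m -> W}) (f : 'rV[R]_n -> 'rV[R]_m) : open D ->
  Ck_on k D f -> Ck_on k D (L \o f).
Proof.
move=> oD; have cL := rV_linear_continuous (L := L).
have dL x : differentiable L x by exact: linear_differentiable.
elim: k f => [|k IH] f /=.
  by move=> cf x Dx; apply: continuous_comp; [exact: cf|exact: cL].
move=> [df Ckf]; split=> [x Dx|v].
  by apply: differentiable_comp; [exact: df|exact: dL].
apply: Ck_on_congr (IH _ (Ckf v)) => // x /set_mem Dx /=.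
rewrite [RHS]deriveE; last by apply: differentiable_comp; [exact: df|exact: dL].
rewrite diff_comp//=; last exact: df.
by rewrite (diff_lin _ cL) deriveE//; exact: df.
Qed.

(** The derivative is ['D_v h] times the same exponential, so the induction closes through
    [Ck_on_scale]. *)
Lemma Ck_on_expR k D (h : 'rV[R]_n -> R) : open D ->
  Ck_on k D h -> Ck_on k D (fun x => expR (h x)).
Proof.
move=> oD; elim: k h => [|k IH] h.
  by move=> ch x Dx; apply: continuous_comp; [exact: ch|exact: continuous_expR].
move=> Ch; have [dh Ckh] := Ch.
have de (y : R) : differentiable (@expR R) y.
  exact/derivable1_diffP/derivable_expR.
split=> [x Dx|v].
  by apply: differentiable_comp; [exact: dh|exact: de].
apply: (Ck_on_congr oD _ (Ck_on_scale oD (Ckh v) (IH _ (Ck_onW Ch)))).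
move=> x /set_mem Dx /=.
rewrite [RHS]deriveE; last by apply: differentiable_comp; [exact: dh|exact: de].
rewrite (diff_comp (dh x Dx) (de _))/= (deriv1E (@derivable_expR _ _)).
by rewrite derive1E derive_val -deriveE//; exact: dh.
Qed.

Lemma Ck_on_sum (W : normedModType R) k D (I : Type) (r : seq I)
    (f : I -> 'rV[R]_n -> W) : open D ->
  (forall i, Ck_on k D (f i)) -> Ck_on k D (fun x => \sum_(i <- r) f i x).
Proof.
move=> oD Cf; elim: r => [|i r IH].
  by apply: Ck_on_congr (Ck_on_cst _ _ 0) => // x _; rewrite big_nil.
by apply: Ck_on_congr (Ck_onD oD (Cf i) IH) => // x _; rewrite big_cons.
Qed.

End Ck.

Lemma diff_sum_partial (R : realType) (m : nat) (W : normedModType R)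
    (f : 'rV[R]_m -> W) (y v : 'rV[R]_m) : differentiable f y ->
  'd f y v = \sum_(k < m) v 0 k *: 'D_(delta_mx 0 k) f y.
Proof.
move=> df; rewrite {1}(row_sum_delta v) linear_sum; apply: eq_bigr => k _.
by rewrite linearZ deriveE.
Qed.

Section row_coordinate.
Context (R : realType) (m : nat) (k : 'I_m).

(** A coordinate is named so that it can carry a linear structure. *)
Definition row_coord (v : 'rV[R]_m) : R := v 0 k.

Lemma row_coord_linear : linear row_coord.
Proof. by move=> a u v; rewrite /row_coord !mxE. Qed.

HB.instance Definition _ := GRing.isLinear.Build _ _ _ _ _ row_coord_linear.

End row_coordinate.

(** The derivative of [f \o t] is the sum of the coordinates of ['D_v t] times the partial
    derivatives of [f] composed with [t]. As [t] is of every class on [D], the induction runs on [f]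
    alone. *)
Lemma Ck_on_comp (R : realType) (n m : nat) (W : normedModType R) (k : nat)
    (D : set 'rV[R]_n) (D' : set 'rV[R]_m) (t : 'rV[R]_n -> 'rV[R]_m)
    (f : 'rV[R]_m -> W) : open D -> open D' -> (forall k, Ck_on k D t) ->
  Ck_on k D' f -> Ck_on k (D `&` t @^-1` D') (f \o t).
Proof.
move=> oD oD' Ct.
have dt x : D x -> differentiable t x by have [+ _] := Ct 1; exact.
have oI : open (D `&` t @^-1` D').
  rewrite openE => x [Dx D'tx]; apply: filterI.
    exact: open_nbhs_nbhs.
  exact: (Ct 0 x Dx _ (open_nbhs_nbhs (conj oD' D'tx))).
elim: k f => [|k IH] f.
  move=> cf x [Dx D'tx]; apply: continuous_comp; [exact: (Ct 0)|exact: cf].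
move=> [df Ckf]; split=> [x [Dx D'tx]|v].
  by apply: differentiable_comp; [exact: dt|exact: df].
apply: (@Ck_on_congr _ _ _ _ _ (fun x => \sum_(j < m)
    row_coord j ('D_v t x) *: ('D_(delta_mx 0 j) f \o t) x)) => //.
  move=> x /set_mem[Dx D'tx].
  rewrite [RHS]deriveE; last first.
    by apply: differentiable_comp; [exact: dt|exact: df].
  rewrite (diff_comp (dt x Dx) (df _ D'tx)) /= -(deriveE _ (dt x Dx)).
  by rewrite (diff_sum_partial _ (df _ D'tx)).
apply: Ck_on_sum => // j; apply: Ck_on_scale => //; last exact: IH (Ckf _).
apply: (Ck_on_sub (@subIsetl _ _ _)).
apply: (Ck_on_linear_comp (row_coord j)) => //.
by have [_ +] := Ct k.+1; exact.
Qed.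

Section smooth_near.
Context (R : realType) (n : nat).
Implicit Types x : 'rV[R]_n.

Lemma smooth_near_congr (W : normedModType R) (f g : 'rV[R]_n -> W) x :
  {near x, f =1 g} -> smooth_near f x -> smooth_near g x.
Proof.
rewrite /prop_near1 nbhsE => -[D' [oD' D'x] fg] [D [oD Dx Cf]].
exists (D' `&` D); split; [exact: openI|by split|move=> k].
apply: (Ck_on_congr _ _ (Ck_on_sub (@subIsetr _ _ _) (Cf k))).
  exact: openI.
by move=> y /set_mem[D'y _]; exact: fg.
Qed.

Lemma smooth_near_differentiable (W : normedModType R) (f : 'rV[R]_n -> W) x :
  smooth_near f x -> \forall y \near x, differentiable f y.
Proof.
move=> [D [oD Dx Cf]]; apply: filterS (open_nbhs_nbhs (conj oD Dx)) => y Dy.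
by have [+ _] := Cf 1; exact.
Qed.

Lemma smooth_near_cst (W : normedModType R) (c : W) x : smooth_near (cst c) x.
Proof.
by exists setT; split=> //; [exact: openT|move=> k; exact: Ck_on_cst].
Qed.

Lemma smooth_near_linear (W : normedModType R) (L : {linear 'rV[R]_n -> W}) x :
  smooth_near L x.
Proof.
by exists setT; split=> //; [exact: openT|move=> k; exact: Ck_on_linear].
Qed.

Lemma smooth_nearD (W : normedModType R) (f g : 'rV[R]_n -> W) x :
  smooth_near f x -> smooth_near g x -> smooth_near (fun y => f y + g y) x.
Proof.
move=> [D [oD Dx Cf]] [D' [oD' D'x Cg]].
have oI := openI oD oD'; exists (D `&` D'); split=> // k.
by apply: Ck_onD => //;
  [apply: Ck_on_sub (Cf k); exact: subIsetl
  |apply: Ck_on_sub (Cg k); exact: subIsetr].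
Qed.

Lemma smooth_near_sum (W : normedModType R) (I : Type) (r : seq I)
    (f : I -> 'rV[R]_n -> W) x :
  (forall i, smooth_near (f i) x) ->
  smooth_near (fun y => \sum_(i <- r) f i y) x.
Proof.
move=> sf; elim: r => [|i r IH].
  apply: smooth_near_congr (smooth_near_cst 0 x).
  by near=> y; rewrite big_nil.
apply: smooth_near_congr (smooth_nearD (sf i) IH).
by near=> y; rewrite big_cons.
Unshelve. all: by end_near. Qed.

Lemma smooth_near_scale (W : normedModType R) (h : 'rV[R]_n -> R)
    (f : 'rV[R]_n -> W) x :
  smooth_near h x -> smooth_near f x -> smooth_near (fun y => h y *: f y) x.
Proof.
move=> [D [oD Dx Cf]] [D' [oD' D'x Cg]].
have oI := openI oD oD'; exists (D `&` D'); split=> // k.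
by apply: Ck_on_scale => //;
  [apply: Ck_on_sub (Cf k); exact: subIsetl
  |apply: Ck_on_sub (Cg k); exact: subIsetr].
Qed.

Lemma smooth_near_linear_comp (m : nat) (W : normedModType R)
    (L : {linear 'rV[R]_m -> W}) (f : 'rV[R]_n -> 'rV[R]_m) x :
  smooth_near f x -> smooth_near (L \o f) x.
Proof.
move=> [D [oD Dx Cf]]; exists D; split=> // k.
exact: Ck_on_linear_comp.
Qed.

Lemma smooth_near_comp (m : nat) (W : normedModType R)
    (t : 'rV[R]_n -> 'rV[R]_m) (f : 'rV[R]_m -> W) x :
  smooth_near t x -> smooth_near f (t x) -> smooth_near (f \o t) x.
Proof.
move=> [D [oD Dx Ct]] [D' [oD' D'x Cf]]; exists (D `&` t @^-1` D').
split=> // [|k]; last exact: Ck_on_comp.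
rewrite openE => y [Dy D'ty]; apply: filterI; first exact: open_nbhs_nbhs.
exact: (Ct 0 y Dy _ (open_nbhs_nbhs (conj oD' D'ty))).
Qed.

Lemma smooth_near_expR (h : 'rV[R]_n -> R) x :
  smooth_near h x -> smooth_near (fun y => expR (h y)) x.
Proof.
move=> [D [oD Dx Cf]]; exists D; split=> // k.
exact: Ck_on_expR.
Qed.

Lemma smooth_near_derive (W : normedModType R) (f : 'rV[R]_n -> W) v x :
  smooth_near f x -> smooth_near ('D_v f) x.
Proof.
move=> [D [oD Dx Cf]]; exists D; split=> // k.
by have [_ +] := Cf k.+1; exact.
Qed.

End smooth_near.

Lemma smooth_near_continuous (R : realType) (n : nat) (W : normedModType R)
    (f : 'rV[R]_n -> W) (x : 'rV[R]_n) :
  smooth_near f x -> {for x, continuous f}.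
Proof. by move=> [D [_ Dx Cf]]; exact: (Cf 0). Qed.

(** Expanded in partial derivatives, a differential at a moving point applied to a moving vector is
    a sum of products of smooth germs. This is how changes of tangent coordinates are shown to be
    smooth. *)
Lemma smooth_near_diff_apply (R : realType) (n m : nat) (W : normedModType R)
    (f : 'rV[R]_m -> W) (P Q : 'rV[R]_n -> 'rV[R]_m) (x : 'rV[R]_n) :
  smooth_near f (P x) -> smooth_near P x -> smooth_near Q x ->
  smooth_near (fun y => 'd f (P y) (Q y)) x.
Proof.
move=> sf sP sQ.
apply: (@smooth_near_congr _ _ _
  (fun y => \sum_(k < m) Q y 0 k *: 'D_(delta_mx 0 k) f (P y))).
  have : \forall y \near x, differentiable f (P y).
    exact: smooth_near_continuous sP _ (smooth_near_differentiable sf).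
  by apply: filterS => y dfy; rewrite (diff_sum_partial _ dfy).
apply: smooth_near_sum => k; apply: smooth_near_scale.
  exact: (smooth_near_linear_comp (row_coord k) sQ).
exact: smooth_near_comp sP (smooth_near_derive _ sf).
Qed.

(** * Tangent vectors in charts *)

(** The chain rule in the form that charts call for: the composite is known only near [x], and the
    base point of [g] is [f x] up to a provable equality. *)
Lemma diff_near_comp (R : realType) (U V W : normedModType R) (f : U -> V)
    (g : V -> W) (h : U -> W) (x : U) (y : V) : f x = y ->
  {near x, g \o f =1 h} -> differentiable f x -> differentiable g y ->
  differentiable h x /\ forall v, 'd h x v = 'd g y ('d f x v).
Proof.
move=> <- gfh df dg.
have [dh E] := near_eq_diff gfh (differentiable_comp df dg).
by split=> [//|v]; rewrite E diff_comp.
Qed.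

(** Keeps the part of [smooth_manifold] that does not mention a topology on [M], so that it also
    makes sense for [TM], which is given no topology here. *)
Record smooth_atlas (R : realType) (M : Type) (n : nat) (A : atlas R M n)
    : Prop := SmoothAtlas {
  atlas_cover : forall p, exists i, dom A i p;
  atlas_chartK : forall i p, dom A i p -> chart_inv A i (chart A i p) = p;
  atlas_near : forall i j p, dom A i p -> dom A j p ->
    \forall z \near chart A i p, [/\ dom A i (chart_inv A i z),
      dom A j (chart_inv A i z) & chart A i (chart_inv A i z) = z];
  atlas_transition : forall i j p, dom A i p -> dom A j p ->
    smooth_near (chart A j \o chart_inv A i) (chart A i p)
}.

Lemma smooth_manifold_atlas (R : realType) (M : topologicalType) (n : nat)
  (A : atlas R M n) : smooth_manifold A -> smooth_atlas A.
Proof.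
move=> mA; split; [exact: dom_cover|exact: chartK| |exact: transition_smooth].
move=> i j p ip jp.
have oU := @chart_open _ _ _ _ mA i.
have Ux : (chart A i @` dom A i) (chart A i p) by exists p.
have nU := open_nbhs_nbhs (conj oU Ux).
have : {for chart A i p, continuous (chart_inv A i)}.
  have := @chart_inv_continuous _ _ _ _ mA i.
  by rewrite continuous_open_subspace//; apply; exact/mem_set.
rewrite /prop_for /continuous_at (chartK mA ip) => ci.
have := ci _ (open_nbhs_nbhs (conj (@dom_open _ _ _ _ mA j) jp)).
apply: filterS2 nU => z [q iq <-] /= jq.
by rewrite (chartK mA iq) in jq *.
Qed.

Section tangent_coordinates.
Context (R : realType) (M : Type) (n : nat) (A : atlas R M n).
Implicit Types p : M.

Lemma tangent_trans p (v : tangent A p) i j : dom A i p -> dom A j p ->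
  v j = 'd (chart A j \o chart_inv A i) (chart A i p) (v i).
Proof. by case: v => v /asboolP[_] vT ip jp /=; exact: vT. Qed.

Lemma tangent_out p (v : tangent A p) i : ~ dom A i p -> v i = 0.
Proof. by case: v => v /asboolP[+ _] /=; exact. Qed.

Lemma tangent_ext p (v w : tangent A p) : (forall i, v i = w i) -> v = w.
Proof. by move=> vw; apply/val_inj/funext. Qed.

Lemma tangentD p (v w : tangent A p) i : (v + w) i = v i + w i.
Proof. by []. Qed.

Lemma tangentN p (v : tangent A p) i : (- v) i = - v i.
Proof. by []. Qed.

Lemma tangentZ p a (v : tangent A p) i : (a *: v) i = a *: v i.
Proof. by []. Qed.

Lemma tangent0 p i : (0 : tangent A p) i = 0.
Proof. by []. Qed.

Lemma tangent_inj p (v w : tangent A p) i : dom A i p -> v i = w i -> v = w.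
Proof.
move=> ip vw; apply: tangent_ext => j; have [jp|jp] := pselect (dom A j p).
  by rewrite (tangent_trans v ip jp) (tangent_trans w ip jp) vw.
by rewrite !tangent_out.
Qed.

Hypothesis sA : smooth_atlas A.

Lemma transition_diff i j p : dom A i p -> dom A j p ->
  differentiable (chart A j \o chart_inv A i) (chart A i p).
Proof.
move=> ip jp.
exact: nbhs_singleton (smooth_near_differentiable (atlas_transition sA ip jp)).
Qed.

Lemma diff_change_chart (W : normedModType R) (f : M -> W) i j p :
  dom A i p -> dom A j p ->
  differentiable (f \o chart_inv A j) (chart A j p) ->
  differentiable (f \o chart_inv A i) (chart A i p) /\
  forall v, 'd (f \o chart_inv A i) (chart A i p) v =
    'd (f \o chart_inv A j) (chart A j p)
       ('d (chart A j \o chart_inv A i) (chart A i p) v).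
Proof.
move=> ip jp df.
have E : (chart A j \o chart_inv A i) (chart A i p) = chart A j p.
  by rewrite /= (atlas_chartK sA ip).
have dt := transition_diff ip jp.
have nE : {near chart A i p, (f \o chart_inv A j) \o
    (chart A j \o chart_inv A i) =1 f \o chart_inv A i}.
  have := atlas_near sA ip jp; apply: filterS => z [_ jz _] /=.
  by rewrite (atlas_chartK sA jz).
exact: diff_near_comp E nE dt df.
Qed.

Lemma tangent_exists i p (z : 'rV[R]_n) : dom A i p ->
  exists v : tangent A p, v i = z.
Proof.
move=> ip.
(* The coordinates in the other charts are forced by those in chart [i]; their compatibility is the
   chain rule for transition maps. *)
pose c j := if pselect (dom A j p)
  then 'd (chart A j \o chart_inv A i) (chart A i p) z else 0.
have cE j : dom A j p ->
    c j = 'd (chart A j \o chart_inv A i) (chart A i p) z.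
  by rewrite /c; case: pselect.
have cP : c \in @tangent_pred _ _ _ A p.
  apply/asboolP; split=> [j jp|j k jp kp]; first by rewrite /c; case: pselect.
  rewrite !cE//.
  have [_ E] := diff_change_chart ip jp (transition_diff jp kp).
  exact: E.
exists (Tangent cP) => /=; rewrite cE//.
(* The transition from chart [i] to itself is known to be the identity only near the point, which
   suffices for its differential. *)
have nE : {near chart A i p, id =1 chart A i \o chart_inv A i}.
  by apply: filterS (atlas_near sA ip ip) => y [_ _ /= ->].
have id_diff : differentiable (@id 'rV[R]_n) (chart A i p) by [].
have [_ E] := near_eq_diff nE id_diff.
by rewrite (congr1 (fun h => h z) E : 'd _ _ _ = _) diff_val.
Qed.

(** By the chain rule the value computed in chart [i] meets the requirement of [dir_deriv] in every
    chart, so it is the one that [xget] returns. *)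
Lemma dir_derivE (W : normedModType R) (f : M -> W) i p (v : tangent A p) :
  dom A i p -> differentiable (f \o chart_inv A i) (chart A i p) ->
  dir_deriv v f = 'd (f \o chart_inv A i) (chart A i p) (v i).
Proof.
move=> ip df; rewrite /dir_deriv; apply: xget_unique.
  move=> j jp; have [_ E] := diff_change_chart jp ip df.
  by apply/esym; rewrite (tangent_trans v jp ip); exact: E.
by move=> w /(_ i ip).
Qed.

Lemma dir_deriv_near_cst (W : normedModType R) (f : M -> W) c i p
    (v : tangent A p) : dom A i p ->
  (\forall z \near chart A i p, f (chart_inv A i z) = c) -> dir_deriv v f = 0.
Proof.
move=> ip fc.
have nE : {near chart A i p, cst c =1 f \o chart_inv A i}.
  by apply: filterS fc => z /= ->.
have [df E] := near_eq_diff nE (differentiable_cst _ _).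
rewrite (dir_derivE v ip df); apply: etrans (congr1 (fun h => h (v i)) E) _.
by rewrite diff_cst.
Qed.

End tangent_coordinates.

(** * The atlas of the tangent bundle *)

(** The difference quotient equals [w] for every nonzero [h], so the derivative is the limit of a
    constant. *)
Lemma derive_affine (R : realType) (V W : normedModType R) (f : V -> W)
    (x v : V) (w : W) :
  (forall h : R, f (h *: v + x) = f x + h *: w) -> 'D_v f x = w.
Proof.
move=> fE; apply/cvg_lim => //; apply: (@cvg_trans _ (cst w @ 0^')).
  apply: near_eq_cvg; near=> h => /=.
  rewrite fE addrC addKr scalerA mulVf ?scale1r//.
  by near: h; exact: nbhs_dnbhs_neq.
exact: cvg_cst.
Unshelve. all: by end_near. Qed.

Section row_embeddings.
Context (R : realType) (m : nat).

(** Embeddings of the base and fibre halves of the coordinates of [TM], named so that they can carry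
    a linear structure. *)
Definition row_inl (x : 'rV[R]_m) : 'rV[R]_(m + m) := row_mx x 0.
Definition row_inr (x : 'rV[R]_m) : 'rV[R]_(m + m) := row_mx 0 x.

Lemma row_inl_linear : linear row_inl.
Proof.
by move=> a x y; rewrite /row_inl scale_row_mx add_row_mx scaler0 addr0.
Qed.

Lemma row_inr_linear : linear row_inr.
Proof.
by move=> a x y; rewrite /row_inr scale_row_mx add_row_mx scaler0 addr0.
Qed.

HB.instance Definition _ := GRing.isLinear.Build _ _ _ _ _ row_inl_linear.
HB.instance Definition _ := GRing.isLinear.Build _ _ _ _ _ row_inr_linear.

Lemma row_mx_inlr (x y : 'rV[R]_m) : row_mx x y = row_inl x + row_inr y.
Proof. by rewrite /row_inl /row_inr add_row_mx addr0 add0r. Qed.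

End row_embeddings.

Section tangent_bundle_atlas.
Context (R : realType) (M : Type) (m : nat) (A : atlas R M m).
Hypothesis sA : smooth_atlas A.
Local Notation B := (TM_atlas A).

Lemma TM_eq (u w : TM A) i : dom A i (TM_proj w) ->
  TM_proj u = TM_proj w -> projT2 u i = projT2 w i -> u = w.
Proof.
case: u w => [p v] [q w] /= iq pq; move: v; rewrite pq => v vw.
by congr existT; exact: tangent_inj iq vw.
Qed.

(** The inverse chart of [TM] picks a vector with [xget]; over the chart domain [tangent_exists]
    provides a candidate, so the choice meets its specification. *)
Lemma TM_inv_coord i (z : 'rV[R]_(m + m)) :
  dom A i (chart_inv A i (lsubmx z)) ->
  projT2 (chart_inv B i z) i = rsubmx z.
Proof.
move=> iz /=; have [v vz] := tangent_exists sA (rsubmx z) iz.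
by apply: (@xgetPex _ 0 [set v : tangent A _ | v i = rsubmx z]); exists v.
Qed.

Lemma TM_near i j (u : TM A) : dom A i (TM_proj u) -> dom A j (TM_proj u) ->
  \forall z \near chart B i u,
    [/\ dom A i (chart_inv A i (lsubmx z)),
        dom A j (chart_inv A i (lsubmx z)) &
        chart A i (chart_inv A i (lsubmx z)) = lsubmx z].
Proof.
move=> iu ju; have := atlas_near sA iu ju.
rewrite -{1}(row_mxKl (chart A i (TM_proj u)) (projT2 u i)) => near_p.
exact: (rV_linear_continuous (L := lsubmx) near_p).
Qed.

Lemma TM_chart_inv i z : dom A i (chart_inv A i (lsubmx z)) ->
  chart A i (chart_inv A i (lsubmx z)) = lsubmx z ->
  chart B i (chart_inv B i z) = z.
Proof.
by move=> iz zK; rewrite [LHS]/= (TM_inv_coord iz) zK hsubmxK.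
Qed.

Local Notation transition i j := (chart A j \o chart_inv A i).

(** The tangent map of the transition map of [M]: an expression of the transition of [TM] free of
    the choices made in [chart_inv]. *)
Definition TM_transition i j (z : 'rV[R]_(m + m)) : 'rV[R]_(m + m) :=
  row_mx (transition i j (lsubmx z))
    ('d (transition i j) (lsubmx z) (rsubmx z)).

Lemma TM_transition_near i j (u : TM A) :
  dom A i (TM_proj u) -> dom A j (TM_proj u) ->
  {near chart B i u, TM_transition i j =1 chart B j \o chart_inv B i}.
Proof.
move=> iu ju; apply: filterS (TM_near iu ju) => z [iz jz zK].
rewrite /TM_transition [RHS]/=; congr row_mx.
have := tangent_trans (projT2 (chart_inv B i z)) iz jz.
by rewrite (TM_inv_coord iz) zK => <-.
Qed.

Lemma TM_smooth_atlas : smooth_atlas B.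
Proof.
split=> [u|i u iu|i j u iu ju|i j u iu ju].
- by have [i iu] := atlas_cover sA (TM_proj u); exists i.
- apply: (@TM_eq _ _ i iu); first by rewrite /= row_mxKl (atlas_chartK sA iu).
  rewrite TM_inv_coord; first by rewrite row_mxKr.
  by rewrite row_mxKl (atlas_chartK sA iu).
- apply: filterS (TM_near iu ju) => z [iz jz zK]; split=> //.
  exact: TM_chart_inv.
(* The fibre half of the transition is a differential at a moving point applied to a moving vector,
   hence smooth. *)
- apply: smooth_near_congr (TM_transition_near iu ju) _.
  have st : smooth_near (transition i j) (lsubmx (chart B i u)).
    by rewrite row_mxKl; exact: atlas_transition.
  have sl := smooth_near_linear_comp (@row_inl R m)
    (smooth_near_comp (smooth_near_linear lsubmx _) st).
  have sr := smooth_near_linear_comp (@row_inr R m)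
    (smooth_near_diff_apply st (smooth_near_linear lsubmx _)
      (smooth_near_linear rsubmx (chart B i u))).
  apply: smooth_near_congr (smooth_nearD sl sr).
  by near=> z; rewrite /TM_transition row_mx_inlr.
Unshelve. all: by end_near. Qed.

End tangent_bundle_atlas.

Lemma diff_lsubmx (R : realType) (m : nat) (z v : 'rV[R]_(m + m)) :
  'd (lsubmx : 'rV[R]_(m + m) -> 'rV[R]_m) z v = lsubmx v.
Proof. by rewrite diff_lin//; exact: continuous_lsubmx. Qed.

Section tangent_bundle_maps.
Context (R : realType) (M : Type) (m : nat) (A : atlas R M m).
Hypothesis sA : smooth_atlas A.
Local Notation B := (TM_atlas A).
Local Notation transition i j := (chart A j \o chart_inv A i).
Let sB := TM_smooth_atlas sA.
Implicit Types u : TM A.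

(** The base half of a transition of [TM] depends only on the base coordinates: with [T] and [t] the
    transitions of [TM] and [M], differentiate [lsubmx \o T = t \o lsubmx], valid near the point. *)
Lemma TM_tangent_lsubmx u (X : tangent B u) i j :
  dom A i (TM_proj u) -> dom A j (TM_proj u) ->
  lsubmx (X j) =
    'd (transition i j) (chart A i (TM_proj u)) (lsubmx (X i)).
Proof.
move=> iu ju; pose z := chart B i u.
have zl : lsubmx z = chart A i (TM_proj u) by rewrite row_mxKl.
have dl w : differentiable (lsubmx : 'rV[R]_(m + m) -> 'rV[R]_m) w.
  exact: differentiable_lsubmx.
have dP := transition_diff sA iu ju.
have dT := @transition_diff _ _ _ _ sB i j u iu ju.
have nE1 : {near z, transition i j \o lsubmx =1 transition i j \o lsubmx}.
  by near=> w.
have [d1 E1] := diff_near_comp zl nE1 (dl z) dP.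
have nE2 : {near z, lsubmx \o (chart B j \o chart_inv B i) =1
    transition i j \o lsubmx}.
  apply: filterS (TM_transition_near sA iu ju) => w E /=.
  by rewrite row_mxKl.
have [d2 E2] := diff_near_comp erefl nE2 dT (dl _).
rewrite (@tangent_trans _ _ _ _ u X i j iu ju).
rewrite -(diff_lsubmx ((chart B j \o chart_inv B i) z)).
apply: (etrans (esym (E2 (X i)))); apply: (etrans (E1 (X i))).
by rewrite diff_lsubmx.
Unshelve. all: by end_near. Qed.

(** With the base point fixed, the transition is affine in the fibre variable, and its linear part
    is the differential of the base transition. *)
Lemma TM_transition_vertical u i j (b : 'rV[R]_m) :
  dom A i (TM_proj u) -> dom A j (TM_proj u) ->
  'd (chart B j \o chart_inv B i) (chart B i u) (row_inr b) =
  row_inr ('d (transition i j) (chart A i (TM_proj u)) b).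
Proof.
move=> iu ju.
have dT := @transition_diff _ _ _ _ sB i j u iu ju.
rewrite -(deriveE _ dT) -(near_eq_derive _ (TM_transition_near sA iu ju)).
apply: derive_affine => h.
rewrite /TM_transition /= /row_inr scale_row_mx add_row_mx !row_mxKl !row_mxKr.
rewrite scaler0 !add0r linearP scale_row_mx add_row_mx scaler0 addr0.
by rewrite addrC.
Qed.

(** The curve has coordinates [(x, y + t w)], hence velocity [(0, w)] in each chart. By
    [TM_transition_vertical] these velocities form one tangent vector, which is the value of
    [xget]. *)
Lemma vertical_liftE u (w : tangent A (TM_proj u)) i :
  dom A i (TM_proj u) -> vertical_lift w i = row_inr (w i).
Proof.
move=> iu.
have [X Xi] := @tangent_exists _ _ _ _ sB i u (row_inr (w i)) iu.
have XE j : dom A j (TM_proj u) -> X j = row_inr (w j).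
  move=> ju; rewrite (@tangent_trans _ _ _ _ u X i j iu ju) Xi.
  by rewrite TM_transition_vertical// (tangent_trans w iu ju).
suff -> : vertical_lift w = X by exact: XE.
rewrite /vertical_lift /velocity.
have vE j : derive1 (chart B j \o
    (fun t => existT _ (TM_proj u) (projT2 u + t *: w))) 0 = row_inr (w j).
  rewrite derive1E; apply: derive_affine => h.
  have cE t : (chart B j \o (fun t => existT _ (TM_proj u)
      (projT2 u + t *: w))) t =
    row_mx (chart A j (TM_proj u)) (projT2 u j + t *: w j) by [].
  rewrite !cE /row_inr scale_row_mx add_row_mx scaler0 addr0 scale0r !addr0.
  by rewrite [h *: 1]mulr1.
apply: xget_unique => [j ju|Y YE]; first by rewrite vE XE.
by apply: (@tangent_inj _ _ _ B u _ _ i iu); rewrite YE// vE XE.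
Qed.

(** Near the point the projection reads [lsubmx] in charts. By [TM_tangent_lsubmx] the base halves
    of [X] form a tangent vector to [M], the only one meeting the specification of
    [differential]. *)
Lemma dpiE u (X : tangent B u) i : dom A i (TM_proj u) ->
  dpi X i = lsubmx (X i).
Proof.
move=> iu.
have [w wi] := tangent_exists sA (lsubmx (X i)) iu.
have wE j : dom A j (TM_proj u) -> w j = lsubmx (X j).
  by move=> ju; rewrite (tangent_trans w iu ju) wi -TM_tangent_lsubmx.
have dE j : dom A j (TM_proj u) ->
    dir_deriv X (chart A j \o @TM_proj _ _ _ A) = lsubmx (X j).
  move=> ju.
  have nE : {near chart B j u,
      lsubmx =1 (chart A j \o @TM_proj _ _ _ A) \o chart_inv B j}.
    by apply: filterS (TM_near sA ju ju) => z [_ _ zK] /=.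
  have [d E] := near_eq_diff nE (differentiable_lsubmx _).
  rewrite (@dir_derivE _ _ _ _ sB _ _ j u X ju d).
  exact: etrans (congr1 (fun h => h (X j)) E) (diff_lsubmx _ _).
suff -> : dpi X = w by exact: wE.
rewrite /dpi /differential.
apply: xget_unique => [j ju|v vE]; first by rewrite dE// wE.
by apply: (tangent_inj iu); rewrite vE// dE// wE.
Qed.

Lemma dpi_linear u : linear (@dpi R M m A u).
Proof.
move=> a X Y; have [i iu] := atlas_cover sA (TM_proj u).
apply: (tangent_inj iu); rewrite tangentD tangentZ !dpiE//.
by rewrite tangentD tangentZ linearP.
Qed.

Lemma dpi_vertical_lift u (w : tangent A (TM_proj u)) :
  dpi (vertical_lift w) = 0.
Proof.
have [i iu] := atlas_cover sA (TM_proj u).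
by apply: (tangent_inj iu); rewrite dpiE// vertical_liftE// row_mxKl tangent0.
Qed.

(** In a chart [dpi X = 0] kills the base half of [X], and the fibre half supplies [w]. *)
Lemma vertical_lift_surj u (X : tangent B u) : dpi X = 0 ->
  exists w, X = vertical_lift w.
Proof.
move=> X0; have [i iu] := atlas_cover sA (TM_proj u).
have [w wi] := tangent_exists sA (rsubmx (X i)) iu.
exists w; apply: (@tangent_inj _ _ _ B u _ _ i iu).
by rewrite vertical_liftE// wi -[LHS]hsubmxK -dpiE// X0 tangent0.
Qed.

Lemma dpi_surj u (w : tangent A (TM_proj u)) :
  exists X : tangent B u, dpi X = w.
Proof.
have [i iu] := atlas_cover sA (TM_proj u).
have [X Xi] := @tangent_exists _ _ _ _ sB i u (row_inl (w i)) iu.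
by exists X; apply: (tangent_inj iu); rewrite dpiE// Xi row_mxKl.
Qed.

End tangent_bundle_maps.

(** * Smooth sections and connections *)

Section smooth_sections.
Context (R : realType).

Lemma smooth_at_chart (N : Type) (n : nat) (B : atlas R N n)
    (W : normedModType R) (h : N -> W) (q : N) i :
  smooth_atlas B -> dom B i q ->
  smooth_near (h \o chart_inv B i) (chart B i q) -> smooth_at B h q.
Proof.
move=> sB iq sh j jq.
have E : (chart B i \o chart_inv B j) (chart B j q) = chart B i q.
  by rewrite /= (atlas_chartK sB jq).
have st := atlas_transition sB jq iq.
rewrite -E in sh; apply: smooth_near_congr (smooth_near_comp st sh).
apply: filterS (atlas_near sB jq iq) => z [_ iz _] /=.
by rewrite (atlas_chartK sB iz).
Qed.

(** The components in a chart [k] come from those in chart [j] through the differential of a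
    transition at a moving point. The hypothesis on neighbourhoods stands in for continuity of
    [f]. *)
Lemma smooth_section_chart (N M : Type) (n m : nat) (B : atlas R N n)
    (A : atlas R M m) (f : N -> M) (s : section_along A f) (q : N) i j :
  smooth_atlas B -> smooth_atlas A -> dom B i q -> dom A j (f q) ->
  smooth_near (chart A j \o f \o chart_inv B i) (chart B i q) ->
  (forall k, dom A k (f q) ->
    \forall z \near chart B i q, dom A k (f (chart_inv B i z))) ->
  smooth_near (fun z => s (chart_inv B i z) j) (chart B i q) ->
  smooth_section_at B s q.
Proof.
move=> sB sA iq jq sf fk ss k kq; apply: (smooth_at_chart sB iq).
have E : (chart A j \o f \o chart_inv B i) (chart B i q) = chart A j (f q).
  by rewrite /= (atlas_chartK sB iq).
have st := atlas_transition sA jq kq; rewrite -E in st.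
apply: smooth_near_congr (smooth_near_diff_apply st sf ss).
apply: filterS2 (fk j jq) (fk k kq) => z jz kz.
exact: esym (tangent_trans (s (chart_inv B i z)) jz kz).
Qed.

Lemma smooth_field_chart (M : Type) (m : nat) (A : atlas R M m)
    (X : vector_field A) (p : M) i : smooth_atlas A -> dom A i p ->
  smooth_near (fun z => X (chart_inv A i z) i) (chart A i p) ->
  smooth_field_at X p.
Proof.
move=> sA ip; apply: (smooth_section_chart sA sA ip ip).
  exact: (atlas_transition sA ip ip).
by move=> k kp; apply: filterS (atlas_near sA ip kp) => z [].
Qed.

Lemma smooth_section_TM_chart (M : Type) (m : nat) (A : atlas R M m)
    (s : section_along A (@TM_proj R M m A)) (u : TM A) i :
  smooth_atlas A -> dom A i (TM_proj u) ->
  smooth_near (fun z => s (chart_inv (TM_atlas A) i z) i)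
    (chart (TM_atlas A) i u) ->
  smooth_section_at (TM_atlas A) s u.
Proof.
move=> sA iu.
move=> ss; apply: (@smooth_section_chart _ _ _ _ (TM_atlas A) _ _ s u i i
  (TM_smooth_atlas sA) sA iu iu _ _ ss).
  apply: smooth_near_congr (smooth_near_linear lsubmx _).
  by apply: filterS (TM_near sA iu iu) => z [_ _ zK] /=.
by move=> k ku; apply: filterS (TM_near sA iu ku) => z [].
Qed.

(** For fixed [z], a field with constant components in chart [i]; only its values over the domain of
    that chart are meaningful. *)
Definition of_coord (M : Type) (m : nat) (A : atlas R M m) (i : chart_index A)
  (p : M) (z : 'rV[R]_m) : tangent A p :=
  xget 0 [set v : tangent A p | v i = z].

Lemma of_coordE (M : Type) (m : nat) (A : atlas R M m) i p (z : 'rV[R]_m) :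
  smooth_atlas A -> dom A i p -> of_coord i p z i = z :> 'rV[R]_m.
Proof.
move=> sA ip; have [v vz] := tangent_exists sA z ip.
by apply: (@xgetPex _ 0 [set v : tangent A _ | v i = z]); exists v.
Qed.

End smooth_sections.

Section connection.
Context (R : realType) (N M : Type) (n m : nat) (B : atlas R N n)
  (A : atlas R M m) (f : N -> M) (D : derivation_along B A f).
Hypotheses (sB : smooth_atlas B) (cD : connection_along D).

Lemma connection_linear0 q (s : section_along A f) :
  smooth_section_at B s q -> @D q 0 s = 0.
Proof.
move=> ss; have := connection_linear cD 1 (0 : tangent B q) 0 ss.
rewrite !scale1r addr0 => /(congr1 (fun v => v - @D q 0 s)).
by rewrite addrK subrr.
Qed.

(* The Leibniz rule only asks the scalar factor to be smooth near [q], so the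
   indicator function of a chart domain can play the part of a bump function. *)
Lemma connection_local q (X : tangent B q) (s t : section_along A f) i :
  dom B i q -> smooth_section_at B s q -> smooth_section_at B t q ->
  (forall q', dom B i q' -> s q' = t q') -> D X s = D X t.
Proof.
move=> iq ss st E.
pose h q' : R := if pselect (dom B i q') then 1 else 0.
have h1 q' : dom B i q' -> h q' = 1 by rewrite /h; case: pselect.
have nh : \forall z \near chart B i q, h (chart_inv B i z) = 1.
  by apply: filterS (atlas_near sB iq iq) => z [/h1].
have sh : smooth_at B h q.
  apply: (smooth_at_chart sB iq).
  apply: smooth_near_congr (smooth_near_cst (1 : R) _).
  by apply: filterS nh => z /= ->.
have hD r : smooth_section_at B r q -> D X (fun q' => h q' *: r q') = D X r.
  move=> sr; rewrite (connection_leibniz cD)// h1// scale1r.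
  by rewrite (dir_deriv_near_cst sB X iq nh) scale0r add0r.
rewrite -(hD _ ss) -(hD _ st); congr (D X _).
apply: functional_extensionality_dep => q'.
have [iq'|iq'] := pselect (dom B i q'); first by rewrite E.
have -> : h q' = 0 by rewrite /h; case: pselect.
by rewrite !scale0r.
Qed.

Lemma smooth_sectionD q (s t : section_along A f) :
  smooth_section_at B s q -> smooth_section_at B t q ->
  smooth_section_at B (fun q' => s q' + t q') q.
Proof.
by move=> ss st j jq i iq; exact: (smooth_nearD (ss j jq i iq) (st j jq i iq)).
Qed.

Lemma smooth_sectionZ q (h : N -> R) (s : section_along A f) :
  smooth_at B h q -> smooth_section_at B s q ->
  smooth_section_at B (fun q' => h q' *: s q') q.
Proof.
by move=> sh ss j jq i iq; exact: (smooth_near_scale (sh i iq) (ss j jq i iq)).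
Qed.

Lemma smooth_section0 q :
  smooth_section_at B (fun q' => 0 : tangent A (f q')) q.
Proof. by move=> j jq i iq; exact: (smooth_near_cst 0). Qed.

Lemma smooth_section_sum q (I : Type) (r : seq I) (s : I -> section_along A f) :
  (forall i, smooth_section_at B (s i) q) ->
  smooth_section_at B (fun q' => \sum_(i <- r) s i q') q.
Proof.
move=> ss; elim: r => [|i r IH].
  rewrite (_ : (fun q' => _) = (fun q' => 0 : tangent A (f q'))).
    exact: smooth_section0.
  by apply: functional_extensionality_dep => q'; rewrite big_nil.
rewrite (_ : (fun q' => _) = (fun q' => s i q' + \sum_(i <- r) s i q')).
  exact: smooth_sectionD.
by apply: functional_extensionality_dep => q'; rewrite big_cons.
Qed.

Lemma connection_sum q (X : tangent B q) (I : Type) (r : seq I)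
    (s : I -> section_along A f) :
  (forall i, smooth_section_at B (s i) q) ->
  D X (fun q' => \sum_(i <- r) s i q') = \sum_(i <- r) D X (s i).
Proof.
move=> ss; elim: r => [|i r IH].
  rewrite big_nil (_ : (fun q' => _) = (fun q' => 0 : tangent A (f q'))).
    have := connection_add cD X (@smooth_section0 q) (@smooth_section0 q).
    rewrite (_ : (fun q' => _ + _) = (fun q' => 0 : tangent A (f q'))).
      by move=> /(congr1 (fun v => v - D X (fun q' => 0))); rewrite addrK subrr.
    by apply: functional_extensionality_dep => q'; rewrite addr0.
  by apply: functional_extensionality_dep => q'; rewrite big_nil.
rewrite big_cons -IH -(connection_add cD X (ss i) (smooth_section_sum r ss)).
by congr (D X _); apply: functional_extensionality_dep => q'; rewrite big_cons.
Qed.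

End connection.

(** * The horizontal and vertical parts *)

Section vertical_projection.
Context (R : realType) (M : Type) (m : nat) (A : atlas R M m)
  (nabla : derivation_along A A id)
  (nablaS : derivation_along (TM_atlas A) A (@TM_proj R M m A)).
Hypotheses (sA : smooth_atlas A) (cN : affine_connection nabla)
  (pN : pullback_connection nabla nablaS).
Local Notation B := (TM_atlas A).
Let sB := TM_smooth_atlas sA.
Let cD : connection_along nablaS := pN.1.
Implicit Types u : TM A.

(** The connection map of [nabla], whose kernel is the horizontal space. *)
Definition connector u (X : tangent B u) : tangent A (TM_proj u) :=
  nablaS X (xi (A := A)).

(** In a bundle chart [xi] is the fibre coordinate [rsubmx], a linear map. *)
Lemma xi_smooth u : smooth_section_at B (xi (A := A)) u.
Proof.
have [i iu] := atlas_cover sA (TM_proj u).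
apply: (smooth_section_TM_chart sA iu).
apply: smooth_near_congr (smooth_near_linear rsubmx _).
apply: filterS (TM_near sA iu iu) => z [iz _ _].
exact: esym (TM_inv_coord sA iz).
Qed.

Lemma connector_linear u : linear (@connector u).
Proof. by move=> a X Y; exact: (connection_linear cD a X Y (@xi_smooth u)). Qed.

Lemma tangent_sum (p : M) (I : Type) (r : seq I) (v : I -> tangent A p) i :
  (\sum_(k <- r) v k) i = \sum_(k <- r) v k i.
Proof.
by elim/big_ind2: _ => // x1 x2 y1 y2 <- <-.
Qed.

Lemma of_coord_smooth i (z : 'rV[R]_m) p : dom A i p ->
  smooth_field_at (fun p => of_coord (A := A) i p z) p.
Proof.
move=> ip; apply: (smooth_field_chart sA ip).
apply: smooth_near_congr (smooth_near_cst z _).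
by apply: filterS (atlas_near sA ip ip) => y [iy _ _]; rewrite of_coordE.
Qed.

Lemma of_coord_pullback_smooth i (z : 'rV[R]_m) u : dom A i (TM_proj u) ->
  smooth_section_at B (fun u' => of_coord (A := A) i (TM_proj u') z) u.
Proof.
move=> iu; apply: (smooth_section_TM_chart sA iu).
apply: smooth_near_congr (smooth_near_cst z _).
by apply: filterS (TM_near sA iu iu) => y [iy _ _]; rewrite of_coordE.
Qed.

(* In a chart [xi = \sum_k y_k E_k] with [E_k] pulled back from [M], so for
   vertical [X] only the derivatives of the fibre coordinates [y_k] remain. *)
Lemma connector_vertical_lift u (w : tangent A (TM_proj u)) :
  connector (vertical_lift w) = w.
Proof.
have [i iu] := atlas_cover sA (TM_proj u).
set X := vertical_lift w.
pose E k (p : M) := of_coord (A := A) i p (delta_mx 0 k).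
pose y (k : 'I_m) (u' : TM A) : R := row_coord k (projT2 u' i).
have y_near k : {near chart B i u,
    row_coord k \o rsubmx =1 y k \o chart_inv B i}.
  apply: filterS (TM_near sA iu iu) => z [iz _ _].
  by rewrite /= /y (TM_inv_coord sA iz).
have sy k : smooth_at B (y k) u.
  apply: (@smooth_at_chart _ _ _ B _ _ u i sB iu).
  apply: smooth_near_congr (y_near k) _.
  exact: smooth_near_linear_comp (smooth_near_linear rsubmx _).
have sE k : smooth_section_at B (fun u' => E k (TM_proj u')) u.
  exact: of_coord_pullback_smooth.
have DE k : nablaS X (fun u' => E k (TM_proj u')) = 0.
  have sEM : smooth_field_at (E k) (TM_proj u) by exact: of_coord_smooth.
  rewrite (pN.2 u X (E k) sEM).
  rewrite -/(dpi X) (dpi_vertical_lift sA).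
  by have := connection_linear0 cN sEM; exact.
have Dy k : dir_deriv X (y k) = row_coord k (w i).
  pose L : {linear 'rV[R]_(m + m) -> R} := row_coord k \o rsubmx.
  have cL : continuous L by exact: rV_linear_continuous.
  have [dy Ey] := near_eq_diff (y_near k) (linear_differentiable _ cL).
  rewrite (@dir_derivE _ _ _ B sB _ _ i u X iu dy).
  apply: (etrans (congr1 (fun h => h (X i)) Ey)).
  rewrite (diff_lin _ cL).
  by rewrite /L /= (vertical_liftE sA w iu) row_mxKr.
(* The frame expansion of [xi] holds only over the domain of chart [i], so locality of the
   connection is invoked. *)
rewrite /connector (connection_local sB cD (i := i)
  (t := fun u' => \sum_(k < m) y k u' *: E k (TM_proj u')) X iu).
- rewrite (connection_sum cD) => [|k]; last exact: smooth_sectionZ.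
  apply: (tangent_inj iu); rewrite tangent_sum [RHS](row_sum_delta (w i)).
  apply: eq_bigr => k _.
  rewrite (connection_leibniz cD X (sy k) (sE k)) DE scaler0 addr0 Dy.
  by rewrite tangentZ of_coordE.
- exact: xi_smooth.
- by apply: smooth_section_sum => k; exact: smooth_sectionZ.
move=> u' iu'; apply: (@tangent_inj _ _ _ A (TM_proj u') _ _ i iu').
rewrite tangent_sum [LHS](row_sum_delta (projT2 u' i)).
by apply: eq_bigr => k _; rewrite tangentZ of_coordE.
Qed.

End vertical_projection.

(** * Homogeneity of the metric *)

Section riemannian_metric_theory.
Context (R : realType) (M : Type) (m : nat) (A : atlas R M m)
  (g : tensor02 A).
Hypothesis rg : riemannian_metric g.

Lemma metricZl p a (u w : tangent A p) : g (a *: u) w = a * g u w.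
Proof.
(* The linearity axiom always carries a second summand; this makes it vanish when that summand is
   taken to be 0. *)
have g0 : g 0 w = 0.
  have := metric_linear rg 1 0 0 w.
  rewrite scale1r addr0 mul1r => /(congr1 (fun x => x - g 0 w)).
  by rewrite addrK subrr.
by have := metric_linear rg a u 0 w; rewrite addr0 g0 addr0.
Qed.

Lemma metricZr p a (u w : tangent A p) : g u (a *: w) = a * g u w.
Proof. by rewrite (Defs.metric_sym rg) metricZl (Defs.metric_sym rg). Qed.

End riemannian_metric_theory.

(** * The splitting of [TTM] and the endomorphism [I_G] in terms of [(dpi, K)] *)

Section horizontal_vertical.
Context (R : realType) (M : Type) (m : nat) (A : atlas R M m)
  (nabla : derivation_along A A id)
  (nablaS : derivation_along (TM_atlas A) A (@TM_proj R M m A)).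
Hypotheses (sA : smooth_atlas A) (cN : affine_connection nabla)
  (pN : pullback_connection nabla nablaS).
Local Notation B := (TM_atlas A).
Let sB := TM_smooth_atlas sA.
Let cD : connection_along nablaS := pN.1.
Local Notation K := (connector nablaS).
Local Notation K_linear := (connector_linear sA pN).
Local Notation K_vertical_lift := (connector_vertical_lift sA cN pN).
Implicit Types u : TM A.

Lemma dpiB u (X Y : tangent B u) : dpi (X - Y) = dpi X - dpi Y.
Proof. exact: (zmod_morphism_linear (dpi_linear sA (u := u))). Qed.

Lemma dpiZ u a (X : tangent B u) : dpi (a *: X) = a *: dpi X.
Proof. exact: (scalable_linear (dpi_linear sA (u := u))). Qed.

Lemma connectorB u (X Y : tangent B u) : K (X - Y) = K X - K Y.
Proof. exact: (zmod_morphism_linear (@K_linear u)). Qed.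

Lemma connectorZ u a (X : tangent B u) : K (a *: X) = a *: K X.
Proof. exact: (scalable_linear (@K_linear u)). Qed.

(** Injectivity of [(dpi, K)]: the difference is vertical, hence the lift of some [w], and [K] reads
    off [w = 0]. *)
Lemma TTM_ext u (X Y : tangent B u) : dpi X = dpi Y -> K X = K Y -> X = Y.
Proof.
move=> dXY KXY; apply/eqP; rewrite -subr_eq0; apply/eqP.
have [|w E] := @vertical_lift_surj _ _ _ _ sA u (X - Y).
  by rewrite dpiB dXY subrr.
have : K (X - Y) = 0 by rewrite connectorB KXY subrr.
rewrite E K_vertical_lift => ->.
have [i iu] := atlas_cover sA (TM_proj u).
by apply: (@tangent_inj _ _ _ B u _ _ i iu); rewrite vertical_liftE// linear0.
Qed.

(** Subtracting the lift of [K X] leaves [dpi] unchanged, the lift being vertical, and cancels [K],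
    which is a left inverse of the lift. *)
Lemma horizontal_proj u (X : tangent B u) :
  dpi (X - vertical_lift (K X)) = dpi X /\ K (X - vertical_lift (K X)) = 0.
Proof.
rewrite dpiB dpi_vertical_lift// subr0; split=> //.
by rewrite connectorB K_vertical_lift subrr.
Qed.

(** [horizontal_proj] supplies a candidate, so the [xget] in [hpart] meets its specification. *)
Lemma hpart_spec u (X : tangent B u) :
  dpi (hpart nablaS X) = dpi X /\ K (hpart nablaS X) = 0.
Proof.
have [dX KX] := horizontal_proj X.
have [|hX vX] := @xgetPex _ 0
  [set Y : tangent B u | horizontal nablaS Y /\ vertical (X - Y)].
  exists (X - vertical_lift (K X)); split; first exact: KX.
  by rewrite /vertical /= dpiB dX subrr.
split; last exact: hX.
by apply/eqP; rewrite eq_sym -subr_eq0 -dpiB; apply/eqP; exact: vX.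
Qed.

Lemma horizontal_lift_spec u (w : tangent A (TM_proj u)) :
  dpi (horizontal_lift nablaS w) = w /\ K (horizontal_lift nablaS w) = 0.
Proof.
have [X dX] := dpi_surj sA w.
have [dX' KX'] := horizontal_proj X.
have [|hX vX] := @xgetPex _ 0
  [set Y : tangent B u | horizontal nablaS Y /\ dpi Y = w].
  exists (X - vertical_lift (K X)); split; first exact: KX'.
  by rewrite dX' dX.
by split; [exact: vX|exact: hX].
Qed.

(** The vertical part is the lift of some [w], which [K] recovers; since [K] vanishes on [hpart], it
    takes the same value on the vertical part as on [X]. *)
Lemma of_vertical_vpart u (X : tangent B u) :
  of_vertical (vpart nablaS X) = K X.
Proof.
have [dX KX] := hpart_spec X.
have [|w E] := @vertical_lift_surj _ _ _ _ sA u (vpart nablaS X).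
  by rewrite /vpart dpiB dX subrr.
have /= := @xgetPex _ 0
  [set w : tangent A (TM_proj u) | vertical_lift w = vpart nablaS X]
  (ex_intro _ w (esym E)).
move=> /(congr1 (fun Y : tangent B u => K Y)); rewrite K_vertical_lift => E'.
by apply: etrans E' _; rewrite /vpart connectorB KX subr0.
Qed.

Lemma weighted_metricE g f1 f2 u (X Y : tangent B u) :
  weighted_metric nablaS g f1 f2 X Y =
  f1 (TM_proj u) * g (TM_proj u) (dpi X) (dpi Y) +
  f2 (TM_proj u) * g (TM_proj u) (K X) (K Y).
Proof.
congr (_ * _ + _ * _).
  exact: (f_equal2 (g (TM_proj u)) (hpart_spec X).1 (hpart_spec Y).1).
exact: (f_equal2 (g (TM_proj u)) (of_vertical_vpart X) (of_vertical_vpart Y)).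
Qed.

Lemma thetaE u (X : tangent B u) : theta nablaS X = vertical_lift (dpi X).
Proof. by rewrite /theta (hpart_spec X).1. Qed.

Lemma theta_tE u (X : tangent B u) :
  theta_t nablaS X = horizontal_lift nablaS (K X).
Proof. by rewrite /theta_t of_vertical_vpart. Qed.

(** Together with [connector_I_G]: in the coordinates [(a, b) = (dpi X, K X)] the endomorphism is
    [(a, b) |-> (e^psi b, - e^(-psi) a)]. *)
Lemma dpi_I_G psi u (X : tangent B u) :
  dpi (I_G nablaS psi X) = expR (psi (TM_proj u)) *: K X.
Proof.
rewrite /I_G thetaE theta_tE dpiB !dpiZ (horizontal_lift_spec (K X)).1.
by rewrite dpi_vertical_lift// scaler0 subr0.
Qed.

Lemma connector_I_G psi u (X : tangent B u) :
  K (I_G nablaS psi X) = - expR (- psi (TM_proj u)) *: dpi X.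
Proof.
rewrite /I_G thetaE theta_tE connectorB !connectorZ.
rewrite (horizontal_lift_spec (K X)).2.
by rewrite K_vertical_lift scaler0 sub0r scaleNr.
Qed.

Lemma weighted_metric_I_G g (rg : riemannian_metric g) f1 f2 psi u
    (X Y : tangent B u) :
  weighted_metric nablaS g f1 f2 (I_G nablaS psi X) Y =
  f1 (TM_proj u) * (expR (psi (TM_proj u)) * g (TM_proj u) (K X) (dpi Y)) -
  f2 (TM_proj u) * (expR (- psi (TM_proj u)) * g (TM_proj u) (dpi X) (K Y)).
Proof.
apply: etrans (weighted_metricE _ _ _ _ _) _; rewrite -mulrN -mulNr.
congr (_ * _ + _ * _); rewrite -(metricZl rg).
  exact: (congr1 (fun v => g _ v _) (dpi_I_G psi X)).
exact: (congr1 (fun v => g _ v _) (connector_I_G psi X)).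
Qed.

(** The preceding formula is used with [I_G Y] in place of [Y]; its minus sign cancels the one in
    [K (I_G Y)]. *)
Lemma weighted_metric_I_G2 g (rg : riemannian_metric g) f1 f2 psi u
    (X Y : tangent B u) :
  weighted_metric nablaS g f1 f2 (I_G nablaS psi X) (I_G nablaS psi Y) =
  f1 (TM_proj u) * (expR (psi (TM_proj u)) *
    (expR (psi (TM_proj u)) * g (TM_proj u) (K X) (K Y))) +
  f2 (TM_proj u) * (expR (- psi (TM_proj u)) *
    (expR (- psi (TM_proj u)) * g (TM_proj u) (dpi X) (dpi Y))).
Proof.
apply: etrans (weighted_metric_I_G rg _ _ _ _ _) _.
rewrite -mulrN -mulrN; congr (_ * (_ * _) + _ * (_ * _)).
  rewrite -(metricZr rg); exact: (congr1 (g _ _) (dpi_I_G psi Y)).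
rewrite -[RHS]opprK -mulNr -(metricZr rg); congr (- _).
exact: (congr1 (g _ _) (connector_I_G psi Y)).
Qed.

Lemma I_G_square psi u (X : tangent B u) :
  I_G nablaS psi (I_G nablaS psi X) = - X.
Proof.
have NE : - X = (-1) *: X by rewrite scaleN1r.
apply: TTM_ext; rewrite NE.
  rewrite dpi_I_G connector_I_G dpiZ scalerA mulrN -expRD subrr expR0.
  by [].
rewrite connector_I_G dpi_I_G connectorZ scalerA mulNr -expRD addNr expR0.
by [].
Qed.

Lemma I_G_linear psi u : linear (@I_G R M m A nablaS psi u).
Proof.
move=> a X Y; apply: TTM_ext.
  apply: (etrans (dpi_I_G _ _)); apply/esym.
  apply: (etrans (dpi_linear sA a (I_G nablaS psi X) (I_G nablaS psi Y))).
  apply: (etrans (f_equal2 (fun v w => a *: v + w)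
    (dpi_I_G psi X) (dpi_I_G psi Y))).
  rewrite (K_linear a X Y).
  by rewrite scalerDr !scalerA [a * _]mulrC.
apply: (etrans (connector_I_G _ _)); apply/esym.
apply: (etrans (K_linear a (I_G nablaS psi X) (I_G nablaS psi Y))).
apply: (etrans (f_equal2 (fun v w => a *: v + w)
  (connector_I_G psi X) (connector_I_G psi Y))).
rewrite (dpi_linear sA a X Y).
by rewrite scalerDr !scalerA [a * _]mulrC.
Qed.

Lemma smooth_pullback (h : M -> R) u i : dom A i (TM_proj u) -> smooth A h ->
  smooth_near (fun z => h (TM_proj (chart_inv B i z))) (chart B i u).
Proof.
move=> iu sh; have := sh (TM_proj u) i iu.
rewrite -{1}(row_mxKl (chart A i (TM_proj u)) (projT2 u i)) => sp.
exact: smooth_near_comp (smooth_near_linear lsubmx (chart B i u)) sp.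
Qed.

(* [L - vertical_lift (K L)] is the horizontal lift of [dpi L]. *)
Lemma I_G_decomp psi u (X L : tangent B u) :
  dpi L = expR (psi (TM_proj u)) *: K X ->
  I_G nablaS psi X = L - vertical_lift (K L +
    expR (- psi (TM_proj u)) *: dpi X).
Proof.
move=> dL; apply: TTM_ext.
  by rewrite dpi_I_G dpiB dpi_vertical_lift// subr0.
rewrite connector_I_G connectorB K_vertical_lift.
by rewrite opprD addrA subrr add0r scaleNr.
Qed.

Lemma I_G_smooth psi u (X : vector_field B) : smooth A psi ->
  smooth_field_at X u ->
  smooth_field_at (fun u' => I_G nablaS psi (X u') : tangent B (id u')) u.
Proof.
move=> spsi sX; have [i iu] := atlas_cover sA (TM_proj u).
have sXi : smooth_near (fun z => X (chart_inv B i z) i) (chart B i u).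
  exact: (sX i iu i iu).
have sp := smooth_pullback iu spsi.
(* By [dpi_I_G], [W] is the [dpi] of [I_G X]. The field [L] below lifts it with zero fibre
   components in chart [i], as [I_G_decomp] requires. *)
pose W : section_along A (@TM_proj R M m A) :=
  fun u' => expR (psi (TM_proj u')) *: K (X u').
have sW : smooth_section_at B W u.
  apply: smooth_sectionZ.
    apply: (@smooth_at_chart _ _ _ B _ _ u i sB iu).
    exact: smooth_near_expR sp.
  exact: (connection_smooth cD sX (xi_smooth sA (u := u))).
pose L : vector_field B := fun u' => of_coord (A := B) i u' (row_inl (W u' i)).
have LE u' : dom A i (TM_proj u') -> L u' i = row_inl (W u' i).
  by move=> iu'; exact: (@of_coordE _ _ _ B i u' _ sB iu').
have dLE u' : dom A i (TM_proj u') -> dpi (L u') = W u'.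
  by move=> iu'; apply: (tangent_inj iu'); rewrite dpiE// LE// row_mxKl.
have sWi : smooth_near (fun z => W (chart_inv B i z) i) (chart B i u).
  exact: (sW i iu i iu).
have dom_near : \forall z \near chart B i u,
    dom A i (TM_proj (chart_inv B i z)).
  by apply: filterS (TM_near sA iu iu) => z [].
have sL : smooth_field_at L u.
  apply: (@smooth_field_chart _ _ _ B L u i sB iu).
  apply: smooth_near_congr (smooth_near_linear_comp (@row_inl R m) sWi).
  by apply: filterS dom_near => z iz; rewrite LE.
have sKL : smooth_section_at B (fun u' => K (L u')) u.
  exact: (connection_smooth cD sL (xi_smooth sA (u := u))).
have sKLi : smooth_near (fun z => K (L (chart_inv B i z)) i) (chart B i u).
  exact: (sKL i iu i iu).
have sNp := smooth_near_expR (smooth_near_scale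
  (smooth_near_cst (-1 : R) (chart B i u)) sp).
have sV := smooth_near_scale (smooth_near_cst (-1 : R) (chart B i u))
  (smooth_nearD sKLi (smooth_near_scale sNp
    (smooth_near_linear_comp lsubmx sXi))).
apply: (@smooth_field_chart _ _ _ B _ u i sB iu).
(* By [I_G_decomp] the components of [I_G X] in chart [i] are [(W, - (K L + e^(-psi) dpi X))]. *)
apply: smooth_near_congr (smooth_nearD
  (smooth_near_linear_comp (@row_inl R m) sWi)
  (smooth_near_linear_comp (@row_inr R m) sV)).
apply: filterS dom_near => z iz.
have -> := I_G_decomp (dLE _ iz).
set v := _ + _ *: dpi _.
have vi : v i = K (L (chart_inv B i z)) i +
    expR (-1 *: psi (TM_proj (chart_inv B i z)) : R) *:
    lsubmx (X (chart_inv B i z) i).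
  by rewrite scaleN1r -(dpiE sA (X (chart_inv B i z)) iz).
rewrite tangentD tangentN (LE _ iz) (vertical_liftE sA v iz) vi.
have row_inrN (x : 'rV[R]_m) : - row_inr x = row_inr (-1 *: x).
  by rewrite scaleN1r linearN.
by rewrite row_inrN.
Qed.

End horizontal_vertical.

(** * The almost complex structure and its associated 2-form *)

Unset Implicit Arguments.
Set Strict Implicit.
Set Printing Implicit Defensive.

Theorem proposition0p3 (R : realType) (M : topologicalType) (m : nat)
    (A : atlas R M m) (g : tensor02 A)
    (nabla : derivation_along A A id)
    (nablaS : derivation_along (TM_atlas A) A (@TM_proj R M m A))
    (phi1 phi2 : M -> R) :
  (2 <= m)%N ->
  smooth_manifold A ->
  riemannian_metric g ->
  metric_connection g nabla ->
  pullback_connection nabla nablaS ->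
  smooth A phi1 -> smooth A phi2 ->
  let f1 := fun p => expR (2 * phi1 p) in
  let f2 := fun p => expR (2 * phi2 p) in
  let psi := fun p => phi2 p - phi1 p in
  let psibar := fun p => phi2 p + phi1 p in
  let G := weighted_metric nablaS g f1 f2 in
  let gS := sasaki_metric nablaS g in
  let IG := I_G nablaS psi in
  let IS := I_S nablaS in
  [/\ almost_complex_structure IG,
      compatible G IG
    & forall (u : TM A) (X Y : tangent (TM_atlas A) u),
        associated_form G IG X Y =
        expR (psibar (TM_proj u)) * associated_form gS IS X Y].
Proof.
move=> _ mA rg [cN _] pN sphi1 sphi2 f1 f2 psi psibar G gS IG IS.
have sA := smooth_manifold_atlas mA.
have spsi : smooth A psi.
  move=> p i ip.
  apply: smooth_near_congr (smooth_nearD (sphi2 p i ip)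
    (smooth_near_scale (smooth_near_cst (-1 : R) _) (sphi1 p i ip))).
  by near=> z; rewrite /= scaleN1r.
have gE := weighted_metricE sA cN pN.
(* The Sasaki structure is the case [psi = 0] with both weights 1, so one formula computes both
   2-forms. *)
have ISE u X : IS u X = I_G nablaS (fun=> 0) X.
  by rewrite /IS /I_S /I_G oppr0 expR0 !scale1r.
split.
- split.
  + by move=> u; exact: I_G_linear sA cN pN psi u.
  + by move=> u X sX; exact: (I_G_smooth sA cN pN spsi sX).
  + by move=> u X; exact: (I_G_square sA cN pN psi X).
- move=> u X Y.
  apply: etrans (weighted_metric_I_G2 sA cN pN rg f1 f2 psi X Y) _.
  apply: etrans (esym (gE g f1 f2 u X Y)); rewrite addrC !mulrA -!expRD.
  (* The exponents balance: [2 phi1 + 2 psi = 2 phi2] and [2 phi2 - 2 psi = 2 phi1]. *)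
  by congr (expR _ * _ + expR _ * _); rewrite /psi; ring.
move=> u X Y; rewrite /associated_form ISE.
apply: etrans (weighted_metric_I_G sA cN pN rg f1 f2 psi X Y) _.
apply: etrans (esym (congr1 ( *%R _)
  (weighted_metric_I_G sA cN pN rg (fun=> 1) (fun=> 1) (fun=> 0) X Y))).
rewrite oppr0 expR0 !mul1r mulrBr !mulrA -!expRD.
(* Both coefficients equal [e^psibar], because [2 phi1 + psi = 2 phi2 - psi = phi2 + phi1]. *)
by congr (expR _ * _ - expR _ * _); rewrite /psi /psibar; ring.
Unshelve. all: by end_near. Qed.
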